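(* Let $R$ be a maximal subring of a ring $T$. If $(R:T)_l$ is a maximal right ideal of $R$, then $T$ has a maximal right $R$-submodule which contains $R$.
   Context: All rings are associative, unital with $1\neq 0$, and not necessarily commutative; subrings contain the identity of the overring; modules are unital. A subring $R\subsetneq T$ is a maximal subring of $T$ if there is no subring $S$ with $R\subsetneq S\subsetneq T$. $(R:T)_l:=\{x\in T\mid Tx\subseteq R\}$ is the largest left ideal of $T$ contained in $R$; it is a two-sided ideal of $R$. *)

(* Defs.v *)
From HB Require Import structures.
From mathcomp Require Import all_boot all_algebra.
From mathcomp Require Import boolp classical_sets.

Set Implicit Arguments.
Unset Strict Implicit.
Unset Printing Implicit Defensive.

Import GRing.Theory.

Local Open Scope classical_set_scope.
Local Open Scope ring_scope.

(* Subrings and submodules are [set T], i.e. Prop-valued predicates, so that no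
   decidability is assumed; [[in A]] is the boolean predicate that the closure
   conditions of MathComp expect. *)
Definition is_subring (T : nzRingType) (R : set T) : Prop :=
  subring_closed [in R].

Definition maximal_subring (T : nzRingType) (R : set T) : Prop :=
  [/\ is_subring R,
      R `<` [set: T] &
      ~ exists S : set T, [/\ is_subring S, R `<` S & S `<` [set: T]] ].

(* Usually denoted (R : T)_l. *)
Definition left_conductor (T : nzRingType) (R : set T) : set T :=
  [set x | forall t : T, R (t * x)].

Definition right_submodule (T : nzRingType) (R M : set T) : Prop :=
  zmod_closed [in M] /\ (forall m r : T, M m -> R r -> M (m * r)).

Definition right_ideal (T : nzRingType) (R I : set T) : Prop :=
  I `<=` R /\ right_submodule R I.

Definition maximal_right_ideal (T : nzRingType) (R I : set T) : Prop :=
  [/\ right_ideal R I,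
      I `<` R &
      ~ exists J : set T, [/\ right_ideal R J, I `<` J & J `<` R] ].

Definition maximal_right_submodule (T : nzRingType) (R M : set T) : Prop :=
  [/\ right_submodule R M,
      M `<` [set: T] &
      ~ exists N : set T, [/\ right_submodule R N, M `<` N & N `<` [set: T]] ].

(* Main.v *)
Require Import Defs.
From HB Require Import structures.
From mathcomp Require Import all_boot all_algebra.
From mathcomp Require Import boolp classical_sets.

Set Implicit Arguments.
Unset Strict Implicit.
Unset Printing Implicit Defensive.

Import GRing.Theory.

Local Open Scope classical_set_scope.
Local Open Scope ring_scope.

(** Write [A] for the left conductor of [R] in [T].  As [A] is a left ideal of
    [T] contained in [R], [T A] is contained in [R], so the nonzero right
    [R]-module [T / R] is killed by [A].  As [A] is a maximal right ideal of [R],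
    every element of [R] outside [A] has a right inverse modulo [A]
    ([maximal_right_ideal_invr]), so [T / R] is a vector space over the division
    ring [R / A], and the preimage in [T] of a hyperplane of it is the submodule
    sought.

    The hyperplane is obtained without passing to quotients: pick [t] outside
    [R] and, by Zorn's lemma, a right submodule [M] containing [R] and maximal
    among those that avoid [t] ([exists_maximal_avoiding]).  If [x] is not in
    [M], then [t = m + x r] with [m] in [M] and [r] in [R]; here [r] is not in
    [A], and inverting it modulo [A] gives [x] in [M + t R]
    ([mem_adjoin_exchange]).  A submodule strictly above [M] contains [t], hence
    every such [x]. *)

(** The nonempty-chain form of [Zorn_bigcup], above a given set. *)
Lemma Zorn_bigcup_above (U : Type) (P : set (set U)) (A : set U) :
    P A ->
    (forall F : set (set U), F !=set0 -> total_on F subset -> F `<=` P ->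
      P (\bigcup_(X in F) X)) ->
  exists M, [/\ P M, A `<=` M & forall B, M `<` B -> ~ P B].
Proof.
move=> PA chP.
(* Adding [A] to each set keeps the empty chain admissible. *)
have [F FP Ftot|M [PM Mmax]] := @Zorn_bigcup U [set X | P (A `|` X)].
  have [->|F0] := eqVneq F set0; first by rewrite /= bigcup_set0 setU0.
  have {}F0 : F !=set0 by apply/set0P.
  rewrite /= -bigcupUr//.
  have -> : \bigcup_(X in F) (A `|` X) =
            \bigcup_(Y in [set A `|` X | X in F]) Y.
    by rewrite bigcup_image.
  apply: chP.
  - by case: F0 => X FX; exists (A `|` X), X.
  - move=> _ _ [X FX <-] [Y FY <-].
    by case: (Ftot X Y FX FY) => XY; [left|right]; apply: setUS.
  - by move=> _ [X FX <-]; apply: FP.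
exists (A `|` M); split=> // B [AMB nBAM] PB.
have AB : A `<=` B by apply: subset_trans AMB.
apply: (Mmax B); last by rewrite /= ((setUidPr A B).2 AB).
split; first exact: subset_trans AMB.
by move=> BM; apply: nBAM => y /BM; right.
Qed.

Section RightSubmodules.
Variable T : nzRingType.
Implicit Types (R M N A : set T) (x y m r s t : T).

Lemma right_submoduleP R M :
  right_submodule R M <->
  [/\ M 0, forall x y, M x -> M y -> M (x - y)
    & forall m r, M m -> R r -> M (m * r)].
Proof.
split=> [[[M0 MB] MM]|[M0 MB MM]].
  split=> //; first by move: M0; rewrite inE.
  by move=> x y Mx My; have := MB x y; rewrite !inE; apply.
split=> //; split; first by rewrite inE.
by move=> x y; rewrite !inE; apply: MB.
Qed.

Lemma right_submoduleD R M x y :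
  right_submodule R M -> M x -> M y -> M (x + y).
Proof.
move=> /right_submoduleP[M0 MB _] Mx My.
by rewrite -[y]opprK; apply: (MB) => //; rewrite -sub0r; apply: MB.
Qed.

Lemma is_subringP R :
  is_subring R <->
  [/\ R 1, forall x y, R x -> R y -> R (x - y)
    & forall x y, R x -> R y -> R (x * y)].
Proof.
split=> [[R1 RB RM]|[R1 RB RM]]; split.
- by move: R1; rewrite inE.
- by move=> x y Rx Ry; have := RB x y; rewrite !inE; apply.
- by move=> x y Rx Ry; have := RM x y; rewrite !inE; apply.
- by rewrite inE.
- by move=> x y; rewrite !inE; apply: RB.
- by move=> x y; rewrite !inE; apply: RM.
Qed.

Lemma right_submodule_subring R : is_subring R -> right_submodule R R.
Proof.
move=> /is_subringP[R1 RB RM]; apply/right_submoduleP; split=> //.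
by rewrite -(subrr 1); apply: RB.
Qed.

Lemma right_submodule_bigcup R (F : set (set T)) :
    F !=set0 -> total_on F subset -> F `<=` right_submodule R ->
  right_submodule R (\bigcup_(X in F) X).
Proof.
move=> [X0 FX0] Ftot FR; apply/right_submoduleP; split.
- by exists X0 => //; have /right_submoduleP[] := FR _ FX0.
- move=> x y [X FX Xx] [Y FY Yy].
  have /right_submoduleP[_ XB _] := FR _ FX.
  have /right_submoduleP[_ YB _] := FR _ FY.
  case: (Ftot X Y FX FY) => XY.
    by exists Y => //; apply: YB => //; apply: XY.
  by exists X => //; apply: XB => //; apply: XY.
- move=> m r [X FX Xm] Rr; exists X => //.
  by have /right_submoduleP[_ _] := FR _ FX; apply.
Qed.

(** The submodule [M + x R] of [T]. *)
Definition adjoin R M x : set T :=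
  [set y | exists m r, [/\ M m, R r & y = m + x * r]].

Lemma sub_adjoin R M x : is_subring R -> M `<=` adjoin R M x.
Proof.
move=> /right_submodule_subring/right_submoduleP[R0 _ _] m Mm.
by exists m, 0; rewrite mulr0 addr0.
Qed.

Lemma mem_adjoin R M x : is_subring R -> right_submodule R M -> adjoin R M x x.
Proof.
move=> /is_subringP[R1 _ _] /right_submoduleP[M0 _ _].
by exists 0, 1; rewrite mulr1 add0r.
Qed.

Lemma right_submodule_adjoin R M x :
  is_subring R -> right_submodule R M -> right_submodule R (adjoin R M x).
Proof.
move=> subR subM.
have [R1 RB RM] := (is_subringP _).1 subR.
have [M0 MB MM] := (right_submoduleP _ _).1 subM.
apply/right_submoduleP; split; first exact: sub_adjoin.
- move=> _ _ [m [r [Mm Rr ->]]] [n [s [Mn Rs ->]]].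
  exists (m - n), (r - s); split; [exact: MB|exact: RB|].
  by rewrite mulrBr opprD addrACA.
- move=> _ s [m [r [Mm Rr ->]]] Rs.
  exists (m * s), (r * s); split; [exact: MM|exact: RM|].
  by rewrite mulrDl mulrA.
Qed.

Lemma adjoin_sub R M N x :
  right_submodule R N -> M `<=` N -> N x -> adjoin R M x `<=` N.
Proof.
move=> subN MN Nx _ [m [r [Mm Rr ->]]].
apply: (right_submoduleD subN); first exact: MN.
by have [_] := subN; apply.
Qed.

Lemma proper_adjoin R M x :
  is_subring R -> right_submodule R M -> ~ M x -> M `<` adjoin R M x.
Proof.
move=> subR subM nMx; split; first exact: sub_adjoin.
by move=> /(_ _ (mem_adjoin x subR subM)).
Qed.

Lemma maximal_right_ideal_invr R A r :
    is_subring R -> maximal_right_ideal R A -> R r -> ~ A r ->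
  exists2 s, R s & A (1 - r * s).
Proof.
move=> subR [[AR subA] _ Amax] Rr nAr.
have [R1 _ _] := (is_subringP _).1 subR.
have subRR := right_submodule_subring subR.
have ArR : adjoin R A r `<=` R by apply: adjoin_sub.
have RAr : R `<=` adjoin R A r.
  apply: contrapT => nRAr; apply: Amax; exists (adjoin R A r); split=> //.
    by split=> //; apply: right_submodule_adjoin.
  exact: proper_adjoin.
have [a [s [Aa Rs ->]]] := RAr _ R1.
by exists s; rewrite ?addrK.
Qed.

(** Steinitz exchange modulo [M]: the hypothesis on [A] makes [T / M] a vector
    space over [R / A]. *)
Lemma mem_adjoin_exchange R M A x t :
    is_subring R -> right_submodule R M -> maximal_right_ideal R A ->
    (forall y a, A a -> M (y * a)) ->
  ~ M t -> adjoin R M x t -> adjoin R M t x.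
Proof.
move=> subR subM maxA TAM nMt [m [r [Mm Rr tE]]].
have [_ MB MM] := (right_submoduleP _ _).1 subM.
have nAr : ~ A r.
  move=> Ar; apply: nMt; rewrite tE.
  by apply: (right_submoduleD subM) => //; apply: TAM.
have [s Rs As] := maximal_right_ideal_invr subR maxA Rr nAr.
exists (x * (1 - r * s) - m * s), s; split=> //.
  by apply: MB; [apply: TAM|apply: MM].
by rewrite tE mulrDl addrA subrK mulrBr mulr1 mulrA subrK.
Qed.

Lemma exists_maximal_avoiding R M t :
    right_submodule R M -> ~ M t ->
  exists N, [/\ right_submodule R N, M `<=` N, ~ N t
    & forall B, right_submodule R B -> N `<` B -> B t].
Proof.
move=> subM nMt.
have [//|F F0 Ftot FP|N [[subN nNt] MN Nmax]] :=
    @Zorn_bigcup_above T [set X | right_submodule R X /\ ~ X t] M.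
  split; first by apply: right_submodule_bigcup => // X /FP[].
  by move=> [X /FP[]].
exists N; split=> // B subB NB.
by apply: contrapT => nBt; apply: (Nmax B).
Qed.

End RightSubmodules.

Theorem corollary2p7 (T : nzRingType) (R : set T)
    (hR : maximal_subring R)
    (hI : maximal_right_ideal R (left_conductor R)) :
  exists M : set T, maximal_right_submodule R M /\ R `<=` M.
Proof.
have [subR [_ nTR] _] := hR.
have [t nRt] : exists t, ~ R t.
  by apply: contrapT => /forallNP RT; apply: nTR => y _; apply: contrapT.
have [M [subM RM nMt Mmax]] :=
  exists_maximal_avoiding (right_submodule_subring subR) nRt.
exists M; split=> //; split=> //.
  by split=> // TM; apply: nMt; apply: TM.
move=> [N [subN MN [_ nTN]]]; apply: nTN => x _.
have Nt : N t := Mmax N subN MN.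
have [Mx|nMx] := pselect (M x); first exact: MN.1.
apply: (adjoin_sub subN MN.1 Nt).
apply: (mem_adjoin_exchange subR subM hI) => //.
  by move=> y a Aa; apply: RM; apply: Aa.
apply: Mmax; first exact: right_submodule_adjoin.
exact: proper_adjoin.
Qed.
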